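(* For all integers $n\ge1$, $d\ge0$ and every $k\ge0$, $$[z^k\zeta^k]\,\mathrm{NN}_{n,d}(z,\zeta,u)=c_k(n,d),$$ where $c_k(n,d)$ is taken in the variables $u_1,\ldots,u_n$.
   Context: For integers $n\ge1$, $d\ge0$ let $A_{n,d}=\{\alpha\in\mathbb{Z}_{\ge0}^n:\alpha_1+\cdots+\alpha_n=d\}$. With indeterminates $z,\zeta,u=(u_1,\ldots,u_n)$ define $$\mathrm{NN}_{n,d}(z,\zeta,u)=\prod_{\alpha\in A_{n,d}}\Bigl(1+z\bigl(1-\prod_{j=1}^n(1-\zeta u_j)^{\alpha_j}\bigr)\Bigr),$$ and let $c_k(n,d)$ be the homogeneous degree-$k$ part of $\prod_{\alpha\in A_{n,d}}(1+\alpha_1u_1+\cdots+\alpha_nu_n)$. $[z^k\zeta^k]$ denotes the coefficient of $z^k\zeta^k$, a polynomial in $u$. *)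

(* Defs.v *)
From mathcomp Require Import all_boot all_order all_algebra.
From mathcomp.multinomials Require Import mpoly.

Set Implicit Arguments.
Unset Strict Implicit.
Unset Printing Implicit Defensive.

Import GRing.Theory.
Local Open Scope ring_scope.

(* Polynomials in z, zeta, u_1, ..., u_n over the integers: the outer
   univariate variable is z, the inner one is zeta. *)
Definition zzetapoly (n : nat) := {poly {poly {mpoly int[n]}}}.

Definition zvar (n : nat) : zzetapoly n := 'X.
Definition zetavar (n : nat) : zzetapoly n := ('X)%:P.
Definition uvar (n : nat) (j : 'I_n) : zzetapoly n := (('X_j)%:P)%:P.

(* The set A_{n,d} is the set of alpha : 'X_{1..n < d.+1} with mdeg alpha == d,
   the bound d.+1 on the degree only serving to obtain a finite type. *)
Definition NN (n d : nat) : zzetapoly n :=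
  \prod_(alpha : 'X_{1..n < d.+1} | mdeg alpha == d)
    (1 + zvar n * (1 - \prod_(j < n) (1 - zetavar n * uvar j) ^+ alpha j)).

Definition coef_z_zeta (n : nat) (p : zzetapoly n) (k l : nat) : {mpoly int[n]} :=
  (p`_k)`_l.

Definition c_ (n d k : nat) : {mpoly int[n]} :=
  pihomog mdeg k
    (\prod_(alpha : 'X_{1..n < d.+1} | mdeg alpha == d)
       (1 + \sum_(j < n) 'X_j *+ alpha j)).

(* Main.v *)
(* Each factor of NN is [1 + z zeta q_alpha] for some polynomial [q_alpha] in
   zeta and u whose value at [zeta = 0] is the linear form
   [L_alpha = \sum_j alpha_j u_j].  Hence the coefficient of [z^k] is [zeta^k]
   times that of [\prod (1 + z q_alpha)], and setting [zeta = 0] there leaves the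
   coefficient of [z^k] in [\prod (1 + z L_alpha)].  As every [L_alpha] is
   homogeneous of degree 1, this coefficient is the degree-k part of the value
   [\prod (1 + L_alpha)] at [z = 1]. *)
Require Import Defs.
From mathcomp Require Import all_boot all_order all_algebra ring.
From mathcomp.multinomials Require Import mpoly.

Set Implicit Arguments.
Unset Strict Implicit.
Unset Printing Implicit Defensive.

Import GRing.Theory.
Local Open Scope ring_scope.

(** Substituting [c *: 'X] for ['X] in the right-hand product gives the left-hand one. *)
Lemma coef_prod_1DXMZ (T : comNzRingType) (I : finType) (P : pred I) (c : T)
    (F : I -> T) (k : nat) :
  (\prod_(i | P i) (1 + 'X * (c * F i)%:P))`_k =
    c ^+ k * (\prod_(i | P i) (1 + 'X * (F i)%:P))`_k.
Proof.
have -> : \prod_(i | P i) (1 + 'X * (c * F i)%:P) =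
    (\prod_(i | P i) (1 + 'X * (F i)%:P)) \Po (c *: 'X).
  rewrite rmorph_prod; apply: eq_bigr => i _ /=.
  rewrite comp_polyD comp_polyM comp_polyX !comp_polyC.
  by rewrite polyCM mulrA ['X * _]mulrC mul_polyC.
move: (\prod_(i | P i) _) => p; elim/poly_ind: p k => [|p a IHp] k.
  by rewrite comp_poly0 !coef0 mulr0.
rewrite comp_polyD comp_polyM comp_polyX comp_polyC -scalerAr.
rewrite !coefD coefZ !coefMX !coefC.
case: k => [|k] /=; first by rewrite !mulr0 !add0r mul1r.
by rewrite !addr0 IHp exprS mulrA.
Qed.

(** Taking the constant coefficient is a ring morphism, so it passes inside the product. *)
Lemma coef0_coef_prod_1DX (T : comNzRingType) (I : finType) (P : pred I)
    (F : I -> {poly T}) (G : I -> T) (k : nat) :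
  (forall i, P i -> (F i)`_0 = G i) ->
  ((\prod_(i | P i) (1 + 'X * (F i)%:P))`_k)`_0 =
    (\prod_(i | P i) (1 + 'X * (G i)%:P))`_k.
Proof.
move=> FG; elim/big_rec2: _ k => [|i p q Pi IH] k.
  by rewrite !coef1; case: k => [|k]; rewrite ?coef1 ?coef0.
rewrite !mulrDl !mul1r !coefD -!mulrA !coefXM !coefCM IH.
by case: k => [|k] /=; rewrite ?coef0 // coef0M FG // IH.
Qed.

Lemma dhomog_coef_prod_1DX (n : nat) (R : comNzRingType) (I : finType)
    (P : pred I) (F : I -> {mpoly R[n]}) (k : nat) :
  (forall i, P i -> F i \is 1.-homog) ->
  (\prod_(i | P i) (1 + 'X * (F i)%:P))`_k \is k.-homog.
Proof.
move=> homF; elim/big_rec: _ k => [|i p Pi IHp] k.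
  by rewrite coef1; case: k => [|k]; rewrite ?dhomog1 ?dhomog0.
rewrite mulrDl mul1r coefD -mulrA coefXM coefCM.
case: k => [|k] /=; first by rewrite addr0.
by rewrite rpredD // -[k.+1]add1n dhomogM ?homF.
Qed.

(** The power of ['X] records the degree: at ['X = 1] the coefficients become the homogeneous
    components. *)
Lemma pihomog_prod_1D (n : nat) (R : comNzRingType) (I : finType)
    (P : pred I) (F : I -> {mpoly R[n]}) (k : nat) :
  (forall i, P i -> F i \is 1.-homog) ->
  pihomog mdeg k (\prod_(i | P i) (1 + F i)) =
    (\prod_(i | P i) (1 + 'X * (F i)%:P))`_k.
Proof.
move=> homF.
have -> : \prod_(i | P i) (1 + F i) = (\prod_(i | P i) (1 + 'X * (F i)%:P)).[1].
  rewrite horner_prod; apply: eq_bigr => i _.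
  by rewrite !hornerE.
have homp := dhomog_coef_prod_1DX _ homF.
set p := (\prod_(i | P i) _) in homp *.
rewrite horner_coef raddf_sum /=.
under eq_bigr do rewrite expr1n mulr1.
case: (ltnP k (size p)) => [ltkp|lepk].
  rewrite (bigD1 (Ordinal ltkp)) //= (pihomog_dE (homp k)).
  rewrite big1 ?addr0 // => i neqi.
  exact: (pihomog_ne0 neqi (homp i)).
(* Here the sum has no term of index [k], and both sides vanish. *)
rewrite nth_default // big1 // => i _.
by apply: (pihomog_ne0 _ (homp i)); rewrite neq_ltn (leq_trans (ltn_ord i)).
Qed.

Lemma one_sub_prod_XM (R : comNzRingType) (I : finType) (u : I -> R)
    (a : I -> nat) :
  exists2 q : {poly R},
    1 - \prod_j (1 - 'X * (u j)%:P) ^+ a j = 'X * q & q`_0 = \sum_j u j *+ a j.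
Proof.
pose ok (p : {poly R}) s := exists2 q, p = 1 - 'X * q & q`_0 = s.
have okM p p' s s' : ok p s -> ok p' s' -> ok (p * p') (s + s').
  (* The witness is read off from expanding [(1 - 'X * q) * (1 - 'X * q')]. *)
  move=> [q -> <-] [q' -> <-]; exists (q + q' - 'X * q * q'); first by ring.
  by rewrite coefB coefD -mulrA coefXM subr0.
have ok1 : ok 1 0 by exists 0; rewrite ?mulr0 ?subr0 ?coef0.
have [q -> q0] : ok (\prod_j (1 - 'X * (u j)%:P) ^+ a j) (\sum_j u j *+ a j).
  elim/big_rec2: _ => // j s p _; apply: (okM).
  elim: (a j) => // m IHm; rewrite exprS mulrS; apply: (okM) => //.
  by exists (u j)%:P; rewrite ?coefC.
by exists q; rewrite // opprB addrCA subrr addr0.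
Qed.

Theorem proposition2p10 (n d k : nat) (hn : (1 <= n)%N) :
  coef_z_zeta (NN n d) k k = c_ n d k.
Proof.
pose L (alpha : 'X_{1..n < d.+1}) : {mpoly int[n]} := \sum_(j < n) 'X_j *+ alpha j.
have /fin_all_exists2[q qE q0] (alpha : 'X_{1..n < d.+1}) :=
  one_sub_prod_XM (fun j => 'X_j : {mpoly int[n]}) alpha.
have homL (alpha : 'X_{1..n < d.+1}) : mdeg alpha == d -> L alpha \is 1.-homog.
  move=> _; apply: rpred_sum => j _; apply: rpredMn.
  by rewrite dhomogX /= mdeg1.
rewrite /c_ (pihomog_prod_1D k homL) /coef_z_zeta /NN.
have -> : \prod_(alpha : 'X_{1..n < d.+1} | mdeg alpha == d)
    (1 + zvar n * (1 - \prod_(j < n) (1 - zetavar n * uvar j) ^+ alpha j)) =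
    \prod_(alpha : 'X_{1..n < d.+1} | mdeg alpha == d) (1 + 'X * ('X * q alpha)%:P).
  (* [zetavar] and [uvar] are constant in z, so the inner product is the [polyC] image of the one in
     [qE]. *)
  apply: eq_bigr => alpha _; rewrite -qE rmorphB rmorph1 rmorph_prod /=.
  congr (1 + _ * (1 - _)); apply: eq_bigr => j _.
  by rewrite rmorphXn rmorphB rmorph1 rmorphM.
(* With [c] equal to zeta, the factor ['X^k] shifts the coefficient of zeta^k to the constant
   one. *)
rewrite coef_prod_1DXMZ coefXnM ltnn subnn.
by apply: coef0_coef_prod_1DX => alpha _; apply: q0.
Qed.
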